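(* Let $\Sigma$ be a $3$-chromatic, not necessarily simple, signed graph, given as input to the algorithm MaxDef (Steps 1–12 described in the context). Then the MaxDef algorithm correctly decides the maximum deficiency $\operatorname{M}(\Sigma)$ of $\Sigma$ and is a finite process.
   Context: **Definitions.** A signed graph $\Sigma=(V,E,\sigma)$ is a graph $(V,E)$ with a signature $\sigma:E\to\{+,-\}$; here it need not be simple. A proper coloration is a function $\kappa$ from $V$ to a color set such that $\kappa(a)\neq\sigma(e)\kappa(b)$ for every edge $e$ with endpoints $a,b$. The color set of size $2k$ is $\{\pm1,\dots,\pm k\}$ and that of size $2k+1$ is $\{\pm1,\dots,\pm k,0\}$. The chromatic number $\chi(\Sigma)$ is the size of the smallest color set with which $\Sigma$ can be properly colored; $\Sigma$ is $3$-chromatic if $\chi(\Sigma)=3$. A coloration is minimal if it is proper and its color set has size $\chi(\Sigma)$ (for a $3$-chromatic graph the color set is $\{1,-1,0\}$). The deficiency of a coloration is the number of unused colors of its color set, and $\operatorname{M}(\Sigma)$ is the maximum deficiency over all minimal proper colorations of $\Sigma$; for $3$-chromatic $\Sigma$ it is $0$ or $1$. $E^{+}$ and $E^{-}$ are the sets of positive and negative edges, $\Sigma^+$ is the subgraph of positive edges, and $V^+$ is the set of vertices incident with at least one positive edge. For a derived signed graph such as $\Sigma_1$, the notations $V_1$, $E_1^+$, $E_1^-$ have the corresponding meaning. A set of vertices is stable in $\Sigma$ if it induces a subgraph with no edges. A vertex cover of $E^+$ is a set of vertices meeting every edge of $E^+$; a stable cover is a vertex cover of $E^+$ that is stable in $\Sigma$.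 **The algorithm MaxDef.** Input: a $3$-chromatic, not necessarily simple, signed graph $\Sigma$, given as two arrays of adjacency lists (positive adjacencies and negative adjacencies). Output: the maximum deficiency, $0$ or $1$, along with a stable vertex cover of $E^+$ if the maximum deficiency is $1$. Throughout, $S$ is a partial stable cover and $B$ is a list of vertices forbidden from $S$; initially $S=B=\emptyset$. Recovery information about which vertices have been identified together is stored. $N_-(v)$ is the set of vertices (of the current graph) negatively adjacent to $v$. ''$X\rightarrow Y$'' means replace $Y$ by $X$. ''$\operatorname{M}(\Sigma)=0$'' or ''$\operatorname{M}(\Sigma)=1$'' in a step means the algorithm ends with that answer. Step 1: Delete all vertices of $\Sigma$ not in $V^+$; call the result $\Sigma_{01}$. Step 2: Let $H_1,\dots,H_r$ be the connected components of $\Sigma_{01}^+$. If some $H_i$ is not bipartite, then $\operatorname{M}(\Sigma)=0$. Otherwise, let $A_i,B_i$ be the parts of the unique bipartition of $H_i$; collapse each $A_i$ to a vertex $a_i$ and each $B_i$ to a vertex $b_i$, eliminate multiple edges of the same sign, and delete the negative edge $a_ib_i$ if it exists. (Negative edges inside $A_i$ or $B_i$ become loops.) The result $\Sigma_{02}$ is a positive perfect matching with all other edges negative. For a matched pair $(a_i,b_i)$, $x_i$ denotes one vertex of the pair and $\bar x_i$ the other. Set $\Sigma_1=\Sigma_{02}$. Step 3: If there is an $i$ with $x_i$ and $\bar x_i$ both in $B$, then $\operatorname{M}(\Sigma)=0$. Otherwise go to Step 4. Step 4: If there is an $i$ with $x_i\in B$, then $S\cup\{\bar x_i\}\rightarrow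 S$, $(B\cup N_-(\bar x_i))\setminus\{x_i\}\rightarrow B$, $\Sigma_1\setminus\{x_i,\bar x_i\}\rightarrow\Sigma_1$, and return to Step 3. Otherwise go to Step 5. Step 5: If there is an $i$ such that $x_i$ and $\bar x_i$ both have loops, then $\operatorname{M}(\Sigma)=0$. Otherwise go to Step 6. Step 6: If there is an $i$ such that $x_i$ has a loop, then $S\cup\{\bar x_i\}\rightarrow S$, $B\cup N_-(\bar x_i)\rightarrow B$, $\Sigma_1\setminus\{x_i,\bar x_i\}\rightarrow\Sigma_1$, and return to Step 3. Otherwise go to Step 7. Step 7: If there is an $i$ such that $x_i$ is adjacent to both $x_j$ and $\bar x_j$ (for some $j$), then $S\cup\{\bar x_i\}\rightarrow S$, $B\cup N_-(\bar x_i)\rightarrow B$, $\Sigma_1\setminus\{x_i,\bar x_i\}\rightarrow\Sigma_1$, and return to Step 3. Otherwise go to Step 8. Step 8: If there are $i\neq j$ such that $x_i$ is adjacent to $x_j$ and $\bar x_i$ is adjacent to $\bar x_j$, then identify $x_i$ with $\bar x_j$ and $\bar x_i$ with $x_j$ in $\Sigma_1$ (removing duplicate edges of the same sign), delete the negative edge $x_i\bar x_i$, and return to Step 3. Otherwise go to Step 9. Step 9: If there is a vertex of degree one, call it $x_i$; then $S\cup\{x_i\}\rightarrow S$, $B\cup N_-(x_i)\rightarrow B$, $\Sigma_1\setminus\{x_i,\bar x_i\}\rightarrow\Sigma_1$ (if $x_i$ and $\bar x_i$ both have degree one, only one of them, it does not matter which, is placed in $S$), and return to Step 3. Otherwise go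 to Step 10. Step 10: If $\Sigma_1$ is the empty graph, then $\operatorname{M}(\Sigma)=1$; use the recovery information to produce a stable cover of $E^+$. Otherwise go to Step 11. Step 11: Create the forcing graph $F(\Sigma_1)$, the directed graph with vertex set $V_1$ and directed edge set $\{x_ix_j : x_i\bar x_j\in E_1^-\}$. Since $\Sigma_1$ has no vertices of degree one, $F(\Sigma_1)$ has minimum outdegree at least $1$, so it contains a directed cycle; and since $x_ix_j$ is an edge if and only if $\bar x_j\bar x_i$ is, there are two cycles, possibly not disjoint: if one uses vertices $x_1,\dots,x_r$, the other uses $\bar x_1,\dots,\bar x_r$. Find such a pair of cycles. Step 12: If the two cycles found in Step 11 are not disjoint, then $\operatorname{M}(\Sigma)=0$. If they are disjoint, identify in $\Sigma_1$ the vertices belonging to each of the two cycles (each cycle to one vertex), eliminate multiple edges of the same sign, delete any negative edge $x_i\bar x_i$, let the result be the new $\Sigma_1$, and return to Step 3.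
   Formalization: A test is added on return to Step 3: if S meets B, then M(Σ)=0. Without it the algorithm is wrong: Step 4 may put a vertex with a negative loop into S and delete it, and the run then ends with M(Σ)=1 although M(Σ)=0. *)

(* Defs.v *)
From mathcomp Require Import all_boot all_order all_algebra.

Set Implicit Arguments.
Unset Strict Implicit.
Unset Printing Implicit Defensive.

Import GRing.Theory Num.Theory.

(* Signed multigraphs, possibly with loops and parallel edges: the two
   endpoints of an edge are stored as a pair whose order is immaterial, and
   [sgn e = true] means that e is positive. *)
Record signed_graph := SignedGraph {
  vertex : finType;
  edge : finType;
  ends : edge -> vertex * vertex;
  sgn : edge -> bool
}.

Section Coloring.
Variable Sg : signed_graph.
Implicit Types (n d : nat) (k : vertex Sg -> int) (C : {set vertex Sg}).

(* {+1, -1, ..., +m, -m} for n = 2m, with 0 added for n = 2m + 1. *)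
Definition colors n : seq int :=
  (if odd n then [:: 0%R] else [::]) ++
  flatten [seq [:: Posz i.+1; (- Posz i.+1)%R] | i <- iota 0 n./2].

Definition properly_colored k : Prop :=
  forall e : edge Sg,
    k (ends e).1 <> (if sgn e then k (ends e).2 else - k (ends e).2)%R.

Definition proper_coloration n k : Prop :=
  (forall v, k v \in colors n) /\ properly_colored k.

Definition chromatic_number n : Prop :=
  (exists k, proper_coloration n k) /\
  (forall m, (exists k, proper_coloration m k) -> n <= m).

Definition deficiency n k : nat :=
  count (fun c => c \notin codom k) (colors n).

(* M(Sg) = d *)
Definition max_deficiency d : Prop :=
  exists n, [/\ chromatic_number n,
    exists k, proper_coloration n k /\ deficiency n k = d
    & forall k, proper_coloration n k -> deficiency n k <= d].

Definition stable C : Prop :=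
  forall e : edge Sg, ~~ (((ends e).1 \in C) && ((ends e).2 \in C)).

Definition covers_positive C : Prop :=
  forall e : edge Sg, sgn e -> ((ends e).1 \in C) || ((ends e).2 \in C).

Definition stable_cover C : Prop := stable C /\ covers_positive C.

End Coloring.

(* The graphs on which the algorithm operates, given by their positive and
   negative adjacencies. Multiplicities are not recorded. *)
Record sgraph (T : finType) := SGraph {
  vert : {set T};
  pos : rel T;
  neg : rel T
}.

Definition joins (Sg : signed_graph) (e : edge Sg) (a b : vertex Sg) : bool :=
  (ends e == (a, b)) || (ends e == (b, a)).

Definition adjacencies (Sg : signed_graph) : sgraph (vertex Sg) :=
  SGraph [set: vertex Sg]
    (fun a b => [exists e : edge Sg, sgn e && joins e a b])
    (fun a b => [exists e : edge Sg, ~~ sgn e && joins e a b]).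

Section GraphOperations.
Variable T : finType.
Implicit Types (G : sgraph T) (A X : {set T}) (x y : T).

Definition induced G X : sgraph T :=
  SGraph (vert G :&: X)
    (fun x y => [&& x \in X, y \in X & pos G x y])
    (fun x y => [&& x \in X, y \in X & neg G x y]).

Definition delete G X : sgraph T := induced G (~: X).

Definition positive_vertices G : {set T} :=
  [set x in vert G | [exists y, pos G x y]].

Definition adj G x y : bool := pos G x y || neg G x y.

Definition Nneg G x : {set T} := [set y | neg G x y].

(* Loops count twice. *)
Definition degree G x : nat :=
  #|[set y | pos G x y]| + #|[set y | neg G x y]| + pos G x x + neg G x x.

Definition component G x : {set T} := [set y in vert G | connect (pos G) x y].

Definition bipartition G (H A : {set T}) : bool :=
  (A \subset H) &&
  [forall x in H, forall y in H, pos G x y ==> ((x \in A) != (y \in A))].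

Definition bipartite G (H : {set T}) : bool :=
  [exists A : {set T}, bipartition G H A].

(* The vertex written x-bar. It is meaningful when the positive edges form a
   perfect matching. *)
Definition mate G x : T := odflt x [pick y | pos G x y].

Definition forcing G : rel T := fun x y => [exists z, pos G y z && neg G x z].

(* Image of G under the identification of vertices with the same value of f. *)
Definition collapse (T' : finType) (f : T -> T') G : sgraph T' :=
  SGraph (f @: vert G)
    (fun a b => [exists x in vert G, exists y in vert G,
                   [&& f x == a, f y == b & pos G x y]])
    (fun a b => [exists x in vert G, exists y in vert G,
                   [&& f x == a, f y == b & neg G x y]]).

(* Delete every negative edge parallel to a positive edge. *)
Definition drop_parallel G : sgraph T :=
  SGraph (vert G) (pos G) (fun x y => neg G x y && ~~ pos G x y).

End GraphOperations.

Section MaxDef.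
Variable V : finType.

(* From Step 2 on, a vertex of the current graph is the set of all the input
   vertices that have been identified into it. This is the recovery
   information: a set S of such vertices stands for [cover S]. *)
Local Notation cvertex := {set V}.
Implicit Types (G : sgraph cvertex) (S B : {set cvertex}).

Definition identify2 (P Q : {set cvertex}) : cvertex -> cvertex :=
  fun z => if z \in P then cover P else if z \in Q then cover Q else z.

Definition identify G (P Q : {set cvertex}) : sgraph cvertex :=
  drop_parallel (collapse (identify2 P Q) G).

(* M0: "M = 0". M1 C: "M = 1", with the cover C. *)
Inductive output := M0 | M1 of {set V}.

(* [AtStep n G S B] is used for 3 <= n <= 11. *)
Inductive state :=
| AtStep1 of sgraph V
| AtStep2 of sgraph V
| AtStep of nat & sgraph cvertex & {set cvertex} & {set cvertex}
| AtStep12 of sgraph cvertex & {set cvertex} & {set cvertex}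
    & seq cvertex & seq cvertex
| Done of output.

Definition cond3 G B : bool :=
  [exists x in vert G, (x \in B) && (mate G x \in B)].

(* S must be a partial stable cover and B is forbidden from S, so M = 0 as soon
   as a vertex forced into S is forbidden. The condition of Step 3 alone does
   not detect the following instance: Step 4 puts a vertex carrying a negative
   loop into S. That vertex, a member of its own negative neighborhood, also
   enters B, but it and its mate leave the graph. *)
Definition conflict S B : bool := S :&: B != set0.

Definition cond4 G B x : bool := (x \in vert G) && (x \in B).

Definition cond5 G x : bool :=
  [&& x \in vert G, neg G x x & neg G (mate G x) (mate G x)].

Definition cond6 G x : bool := (x \in vert G) && neg G x x.

Definition cond7 G x : bool :=
  (x \in vert G) && [exists y in vert G, adj G x y && adj G x (mate G y)].

Definition cond8 G x y : bool :=
  [&& x \in vert G, y \in vert G, y != x, y != mate G x,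
      adj G x y & adj G (mate G x) (mate G y)].

Definition cond9 G x : bool := (x \in vert G) && (degree G x == 1).

Inductive maxdef_step : state -> state -> Prop :=
| Step1 (G : sgraph V) :
    maxdef_step (AtStep1 G) (AtStep2 (induced G (positive_vertices G)))
| Step2_stop (G : sgraph V) v :
    v \in vert G -> ~~ bipartite G (component G v) ->
    maxdef_step (AtStep2 G) (Done M0)
| Step2 (G : sgraph V) (part : V -> {set V}) :
    (forall v, v \in vert G ->
       v \in part v /\ bipartition G (component G v) (part v)) ->
    maxdef_step (AtStep2 G)
      (AtStep 3 (drop_parallel (collapse part G)) set0 set0)
| Step3_stop G S B :
    cond3 G B -> maxdef_step (AtStep 3 G S B) (Done M0)
| Step3_conflict G S B :
    conflict S B -> maxdef_step (AtStep 3 G S B) (Done M0)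
| Step3_next G S B :
    ~~ cond3 G B -> ~~ conflict S B ->
    maxdef_step (AtStep 3 G S B) (AtStep 4 G S B)
| Step4 G S B x :
    cond4 G B x ->
    maxdef_step (AtStep 4 G S B)
      (AtStep 3 (delete G [set x; mate G x])
         (S :|: [set mate G x]) ((B :|: Nneg G (mate G x)) :\: [set x]))
| Step4_next G S B :
    (forall x, ~~ cond4 G B x) ->
    maxdef_step (AtStep 4 G S B) (AtStep 5 G S B)
| Step5_stop G S B x :
    cond5 G x -> maxdef_step (AtStep 5 G S B) (Done M0)
| Step5_next G S B :
    (forall x, ~~ cond5 G x) ->
    maxdef_step (AtStep 5 G S B) (AtStep 6 G S B)
| Step6 G S B x :
    cond6 G x ->
    maxdef_step (AtStep 6 G S B)
      (AtStep 3 (delete G [set x; mate G x])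
         (S :|: [set mate G x]) (B :|: Nneg G (mate G x)))
| Step6_next G S B :
    (forall x, ~~ cond6 G x) ->
    maxdef_step (AtStep 6 G S B) (AtStep 7 G S B)
| Step7 G S B x :
    cond7 G x ->
    maxdef_step (AtStep 7 G S B)
      (AtStep 3 (delete G [set x; mate G x])
         (S :|: [set mate G x]) (B :|: Nneg G (mate G x)))
| Step7_next G S B :
    (forall x, ~~ cond7 G x) ->
    maxdef_step (AtStep 7 G S B) (AtStep 8 G S B)
| Step8 G S B x y :
    cond8 G x y ->
    maxdef_step (AtStep 8 G S B)
      (AtStep 3 (identify G [set x; mate G y] [set mate G x; y]) S B)
| Step8_next G S B :
    (forall x y, ~~ cond8 G x y) ->
    maxdef_step (AtStep 8 G S B) (AtStep 9 G S B)
| Step9 G S B x :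
    cond9 G x ->
    maxdef_step (AtStep 9 G S B)
      (AtStep 3 (delete G [set x; mate G x])
         (S :|: [set x]) (B :|: Nneg G x))
| Step9_next G S B :
    (forall x, ~~ cond9 G x) ->
    maxdef_step (AtStep 9 G S B) (AtStep 10 G S B)
| Step10_stop G S B :
    vert G = set0 -> maxdef_step (AtStep 10 G S B) (Done (M1 (cover S)))
| Step10_next G S B :
    vert G <> set0 -> maxdef_step (AtStep 10 G S B) (AtStep 11 G S B)
| Step11 G S B (c : seq cvertex) :
    c != [::] -> ucycle (forcing G) c ->
    maxdef_step (AtStep 11 G S B)
      (AtStep12 G S B c (rev [seq mate G x | x <- c]))
| Step12_stop G S B (c c' : seq cvertex) :
    has (mem c) c' -> maxdef_step (AtStep12 G S B c c') (Done M0)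
| Step12 G S B (c c' : seq cvertex) :
    ~~ has (mem c) c' ->
    maxdef_step (AtStep12 G S B c c')
      (AtStep 3 (identify G [set x in c] [set x in c']) S B).

End MaxDef.

Arguments M0 {V}.

(* [maxdef_run Sg n s]: some execution on input Sg is in state s after n
   transitions. Every choice left open by the algorithm is allowed. *)
Inductive maxdef_run (Sg : signed_graph) : nat -> state (vertex Sg) -> Prop :=
| run_start : maxdef_run 0 (AtStep1 (adjacencies Sg))
| run_step n s s' :
    maxdef_run n s -> maxdef_step s s' -> maxdef_run n.+1 s'.

Arguments maxdef_run Sg n s : clear implicits.

Definition correct_output (Sg : signed_graph) (o : output (vertex Sg)) : Prop :=
  match o with
  | M0 => max_deficiency Sg 0
  | M1 C => max_deficiency Sg 1 /\ stable_cover C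
  end.

Arguments correct_output Sg o : clear implicits.

(* Main.v *)
(* With three colors, a coloration misses a color exactly when, up to a sign
   change, its values are 0 and 1, and then the vertices of color 0 form a
   stable cover; so M(Sigma) = 1 iff Sigma has a stable cover.

   Once Step 2 is done, the positive edges of the current graph G are a perfect
   matching, and a stable cover of G contains exactly one vertex of each matched
   pair. The loop preserves two implications: a stable cover of the input gives
   a stable cover of G that avoids B, together with S and B disjoint;
     conversely,
   if S and B are disjoint and C is a stable cover of G that avoids B, then
   S and C together expand to a stable cover of the input. Steps 4, 6, 7 and 9
   put in S a vertex that some cover of G avoiding B contains, if there is any
   such cover. Steps 2, 8 and 12 identify vertices that every cover contains
   all together or not at all; along a cycle of the forcing graph this holds
   because membership in a cover propagates along its arcs. Each return to
   Step 3 loses a vertex, because the forcing graph has no loops. *)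

Require Import Defs.
From mathcomp Require Import all_boot all_order all_algebra.

Set Implicit Arguments.
Unset Strict Implicit.
Unset Printing Implicit Defensive.

Import GRing.Theory Num.Theory.

(** * Deficiency and stable covers *)

Section StableCoverColorings.
Variable Sg : signed_graph.
Hypothesis chi3 : chromatic_number Sg 3.
Implicit Types (k : vertex Sg -> int) (C : {set vertex Sg}).

Lemma deficiency3 k :
  deficiency 3 k =
    (0%R \notin codom k) + (1%R \notin codom k) + ((-1)%R \notin codom k).
Proof. by rewrite /deficiency /= addn0 addnA. Qed.

(** A coloring without 0 would use only 1 and -1, a color set of size 2. *)
Lemma zero_used k : proper_coloration 3 k -> 0%R \in codom k.
Proof.
case=> colk propk; apply/negPn/negP => n0.
suff /(chi3.2 2) : exists k, @proper_coloration Sg 2 k by [].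
exists k; split=> // v; have := colk v; rewrite /colors /= !inE.
by case: eqP => //= kv0; rewrite -kv0 codom_f in n0.
Qed.

(** Otherwise the color set {0} of size 1 would suffice. *)
Lemma nonzero_used k :
  proper_coloration 3 k -> (1%R \in codom k) || ((-1)%R \in codom k).
Proof.
case=> colk propk; apply/negPn/negP; rewrite negb_or => /andP[n1 nN1].
suff /(chi3.2 1) : exists k, @proper_coloration Sg 1 k by [].
exists k; split=> // v; have := colk v; rewrite /colors /= !inE.
by case/or3P=> // /eqP kv; [case/negP: n1 | case/negP: nN1]; apply/codomP;
  exists v.
Qed.

Lemma deficiency3_le1 k : proper_coloration 3 k -> deficiency 3 k <= 1.
Proof.
move=> propk; rewrite deficiency3 zero_used //=.
by case/orP: (nonzero_used propk) => -> //=; rewrite ?addn0; case: (_ \notin _).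
Qed.

(** Since 0 = -0, no edge of either sign joins two vertices colored 0; a positive edge avoiding
    color 0 would have both ends colored [c]. *)
Lemma two_colors_stable_cover k (c : int) :
    c <> (- c)%R -> properly_colored k ->
    (forall v, k v = 0%R \/ k v = c) ->
  stable_cover [set v | k v == 0%R].
Proof.
move=> cN propk kc; split=> e; have := propk e; rewrite !inE.
  move=> ne; apply/negP => /andP[/eqP k1 /eqP k2]; apply: ne.
  by rewrite k1 k2 oppr0 if_same.
move=> ne sg; rewrite sg in ne.
by case: (kc (ends e).1) ne => -> //=; case: (kc (ends e).2) => ->;
  rewrite ?eqxx ?orbT.
Qed.

Lemma deficient_stable_cover k :
  proper_coloration 3 k -> 0 < deficiency 3 k -> exists C, stable_cover C.
Proof.
move=> propk; rewrite deficiency3 zero_used //= addn_gt0 !lt0b => unused.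
exists [set v | k v == 0%R]; case: (propk) => colk pk.
have [n1|nN1] := orP unused.
  apply: (two_colors_stable_cover (c := (-1)%R)) pk _ => // v.
  have := colk v; rewrite /colors /= !inE => /or3P[] /eqP kv; auto.
  by case/negP: n1; apply/codomP; exists v.
apply: (two_colors_stable_cover (c := 1%R)) pk _ => // v.
have := colk v; rewrite /colors /= !inE => /or3P[] /eqP kv; auto.
by case/negP: nN1; apply/codomP; exists v.
Qed.

Lemma max_deficiency1 C : stable_cover C -> max_deficiency Sg 1.
Proof.
case=> stC covC; pose k v : int := if v \in C then 0%R else 1%R.
have propk : proper_coloration 3 k.
  split=> [v|e]; rewrite /k; first by case: ifP.
  have := stC e; have := covC e.
  by case: (sgn e) => //= [/(_ isT)|_]; do 2!case: (_ \in C).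
exists 3; split=> //; last exact: deficiency3_le1.
exists k; split=> //; apply/eqP; rewrite eqn_leq deficiency3_le1 //=.
rewrite deficiency3 (_ : (-1)%R \notin codom k) ?addn1 //.
by apply/codomP => -[v]; rewrite /k; case: ifP.
Qed.

Lemma max_deficiency0 :
  ~ (exists C, @stable_cover Sg C) -> max_deficiency Sg 0.
Proof.
move=> nocover.
have def0 k : proper_coloration 3 k -> deficiency 3 k = 0.
  by move=> propk; apply/eqP; rewrite -leqn0 leqNgt; apply/negP =>
    /(deficient_stable_cover propk).
exists 3; split=> //; first by have [[k propk] _] := chi3; exists k; auto.
by move=> k /def0 ->.
Qed.

End StableCoverColorings.

(** * Covers of graphs with matched vertices *)

Section Graphs.
Variable T : finType.
Implicit Types (G : sgraph T) (C X : {set T}).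

Definition sgraph_cover G C : Prop :=
  [/\ C \subset vert G, {in C &, forall x y, ~~ adj G x y}
    & forall x y, pos G x y -> (x \in C) || (y \in C)].

Record undirected G : Prop := Undirected {
  pos_vert : forall x y, pos G x y -> x \in vert G;
  neg_vert : forall x y, neg G x y -> x \in vert G;
  pos_sym : symmetric (pos G);
  neg_sym : symmetric (neg G)
}.

(** The shape reached in Step 2 and kept by the loop; [pos_neg] records that negative edges joining
    a matched pair have been deleted. *)
Record matching G : Prop := Matching {
  matching_undirected :> undirected G;
  pos_irr : irreflexive (pos G);
  pos_fun : forall x y z, pos G x y -> pos G x z -> y = z;
  pos_ex : forall x, x \in vert G -> exists y, pos G x y;
  pos_neg : forall x y, pos G x y -> ~~ neg G x y
}.

Lemma undirected_induced G X : undirected G -> undirected (induced G X).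
Proof.
move=> uG; split=> /= x y.
- by case/and3P=> xX _ /(pos_vert uG) xG; rewrite inE xG.
- by case/and3P=> xX _ /(neg_vert uG) xG; rewrite inE xG.
- by rewrite (pos_sym uG) andbCA.
- by rewrite (neg_sym uG) andbCA.
Qed.

(** Covering gives at least one end of the positive edge, stability at most one. *)
Lemma sgraph_cover_pos G C x y :
  sgraph_cover G C -> pos G x y -> (y \in C) = (x \notin C).
Proof.
case=> _ stC covC pxy; have := covC x y pxy; have := stC x y.
rewrite /adj pxy; case: (x \in C) => //=; case: (y \in C) => //=.
by move=> /(_ isT isT).
Qed.

Lemma sgraph_cover_neg G C x y :
  sgraph_cover G C -> neg G x y -> x \in C -> y \notin C.
Proof.
case=> _ stC _ nxy xC; apply/negP => yC.
by have := stC x y xC yC; rewrite /adj nxy orbT.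
Qed.

Lemma sgraph_cover_delete G C X :
  sgraph_cover G C -> sgraph_cover (delete G X) (C :\: X).
Proof.
case=> sCG stC covC; split=> [|x y|x y /=].
- by rewrite /= setDE setSI.
- rewrite !inE => /andP[xX xC] /andP[yX yC].
  by have := stC x y xC yC; rewrite /adj /= !inE xX yX.
- by rewrite !inE => /and3P[-> ->]; exact: covC.
Qed.

(** * Matched pairs and the forcing graph *)

Section Mate.
Variable G : sgraph T.
Hypothesis mG : matching G.
Local Notation "x ^*" := (mate G x).

Lemma mate_eq x y : pos G x y -> x^* = y.
Proof.
by rewrite /mate => pxy; case: pickP => [z /(pos_fun mG pxy) //|/(_ y)];
  rewrite pxy.
Qed.

Lemma pos_mate x : x \in vert G -> pos G x x^*.
Proof. by case/(pos_ex mG) => y pxy; rewrite (mate_eq pxy). Qed.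

Lemma mate_vert x : x \in vert G -> x^* \in vert G.
Proof. by move/pos_mate; rewrite (pos_sym mG) => /(pos_vert mG). Qed.

Lemma mateK x : x \in vert G -> x^*^* = x.
Proof. by move=> xG; apply: mate_eq; rewrite (pos_sym mG) pos_mate. Qed.

Lemma mate_neq x : x \in vert G -> x^* != x.
Proof.
by move/pos_mate => pxx; apply/eqP => e; rewrite e (pos_irr mG) in pxx.
Qed.

Lemma sgraph_cover_mate C x :
  sgraph_cover G C -> x \in vert G -> (x^* \in C) = (x \notin C).
Proof. by move=> cC xG; apply: sgraph_cover_pos cC _; exact: pos_mate. Qed.

Lemma forcingP x y : forcing G x y -> y \in vert G /\ neg G x y^*.
Proof. by case/existsP=> z /andP[/[dup] /(pos_vert mG) yG /mate_eq ->]. Qed.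

(** The arc is a negative edge from [x] to the mate of [y], so a cover with [x] omits that mate and
    contains [y]. *)
Lemma forcing_cover C x y :
  sgraph_cover G C -> forcing G x y -> x \in C -> y \in C.
Proof.
move=> cC /forcingP[yG nxy] /(sgraph_cover_neg cC nxy).
by rewrite sgraph_cover_mate // negbK.
Qed.

Lemma forcing_irr x : ~~ forcing G x x.
Proof.
apply/negP=> /forcingP[xG nxx]; have /(pos_neg mG) := pos_mate xG.
by rewrite nxx.
Qed.

Lemma cycle_forcing_vert c : cycle (forcing G) c -> {subset c <= vert G}.
Proof.
move=> cycc x xc.
have /forcingP[] // := prev_cycle cycc xc.
Qed.

Lemma path_forcing_cover C x p :
    sgraph_cover G C -> path (forcing G) x p -> x \in C -> {subset p <= C}.
Proof.
move=> cC; elim: p x => //= z p IH x /andP[fxz pz] xC.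
have zC := forcing_cover cC fxz xC.
by move=> y; rewrite inE => /predU1P[-> //|]; exact: IH pz zC y.
Qed.

Lemma cycle_forcing_cover C c x :
    sgraph_cover G C -> cycle (forcing G) c -> x \in c -> x \in C ->
  {subset c <= C}.
Proof.
(* Rotated to start at [x], the cycle is a closed path from [x], along which membership
   propagates. *)
move=> cC cycc xc xC y; have [i p def_p] := rot_to xc.
rewrite -(mem_rot i) def_p -mem_rcons; apply: path_forcing_cover cC _ xC y.
by rewrite -(rot_cycle i) def_p in cycc.
Qed.

Lemma matching_delete x :
  x \in vert G -> matching (delete G [set x; x^*]).
Proof.
move=> xG; split=> [|y|y z w|y|y z] /=.
- exact: undirected_induced (matching_undirected mG).
- by rewrite (pos_irr mG) !andbF.
- by move=> /and3P[_ _ pyz] /and3P[_ _]; exact: pos_fun pyz.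
- rewrite !inE negb_or => /and3P[yG yx yx']; exists y^*.
  rewrite !inE !negb_or yx yx' pos_mate //= andbT.
  apply/andP; split.
    by apply: contraNneq yx' => <-; rewrite mateK.
  by apply: contraNneq yx => e; rewrite -(mateK yG) e mateK.
- by case/and3P=> -> -> /=; exact: pos_neg.
Qed.

(** Matched pairs are deleted whole, so every positive edge either contains [x] or survives in the
    smaller graph. *)
Lemma sgraph_cover_restore C x :
    x \in vert G -> ~~ neg G x x -> {in C, forall y, ~~ neg G x y} ->
  sgraph_cover (delete G [set x; x^*]) C -> sgraph_cover G (x |: C).
Proof.
move=> xG nxx nxC [sCG stC covC].
have CG y : y \in C -> [/\ y \in vert G, y != x & y != x^*].
  by move/(subsetP sCG); rewrite !inE negb_or => /andP[-> /andP[-> ->]].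
have nadj y : y \in C -> ~~ adj G x y.
  move=> yC; rewrite /adj negb_or nxC // andbT.
  by apply/negP => /mate_eq e; have [_ _] := CG y yC; rewrite e eqxx.
split.
- by apply/subsetP => y /setU1P[-> //|/CG[]].
- move=> y z /setU1P[->|yC] /setU1P[->|zC].
  + by rewrite /adj (pos_irr mG).
  + exact: nadj.
  + by rewrite /adj (pos_sym mG) (neg_sym mG) nadj.
  + have := stC y z yC zC; have [_ y1 y2] := CG y yC; have [_ z1 z2] := CG z zC.
    by rewrite /adj /= !inE !negb_or y1 y2 z1 z2.
- move=> y z pyz; rewrite !inE.
  have [->|yx] := eqVneq y x; first by [].
  have [->|zx] := eqVneq z x; first by rewrite orbT.
  apply: (covC y z) => /=; rewrite !inE !negb_or yx zx pyz /= andbT.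
  apply/andP; split.
    apply: contraNneq zx => e; rewrite -(mate_eq pyz) e mateK //.
  apply: contraNneq yx => e; rewrite (pos_sym mG) in pyz.
  by rewrite -(mate_eq pyz) e mateK.
Qed.

(** The positive edge to the mate already accounts for the whole degree. *)
Lemma leaf_no_neg x y : x \in vert G -> degree G x = 1 -> ~~ neg G x y.
Proof.
move=> xG deg1; apply/negP => nxy; move: deg1; rewrite /degree.
have: 0 < #|[set y | pos G x y]|.
  by apply/card_gt0P; exists x^*; rewrite inE pos_mate.
have: 0 < #|[set y | neg G x y]| by apply/card_gt0P; exists y; rewrite inE.
by case: #|_| => // m; case: #|_| => // p _ _; rewrite addSn addnS !addSn.
Qed.

Lemma nonleaf_neg x : x \in vert G -> degree G x != 1 -> exists y, neg G x y.
Proof.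
move=> xG deg1; have [y nxy|nx] := pickP (neg G x); first by exists y.
case/eqP: deg1; rewrite /degree (pos_irr mG) nx !addn0.
rewrite (_ : [set y | pos G x y] = [set x^*]); last first.
  apply/setP => y; rewrite !inE.
  by apply/idP/eqP => [/mate_eq //|->]; exact: pos_mate.
by rewrite cards1 (_ : [set y | neg G x y] = set0) ?cards0 //; apply/setP => y;
  rewrite !inE nx.
Qed.

(** Every vertex has an arc leading to the mate of a negative neighbor. Choosing one arc from each
    vertex gives a self-map of the vertices; it permutes any minimal nonempty closed set, and an
    orbit there is a simple cycle. *)
Lemma forcing_cycle_ex :
    vert G <> set0 -> {in vert G, forall x, degree G x != 1} ->
  exists2 c, c != [::] & ucycle (forcing G) c.
Proof.
move=> /eqP/set0Pn[x0 x0G] nleaf.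
have next x : exists y, (x \in vert G) ==> forcing G x y.
  case: (boolP (x \in vert G)) => [xG|]; last by exists x.
  have [z nxz] := nonleaf_neg xG (nleaf x xG).
  exists z^*; apply/existsP; exists z; rewrite nxz andbT (pos_sym mG).
  by apply: pos_mate; move: nxz; rewrite (neg_sym mG) => /(neg_vert mG).
pose f x := xchoose (next x).
have fP x : x \in vert G -> forcing G x (f x) := implyP (xchooseP (next x)).
have fG x : x \in vert G -> f x \in vert G by move=> /fP /forcingP[].
pose closedf (X : {set T}) := [&& X != set0, X \subset vert G & f @: X \subset
  X].
have : closedf (vert G).
  apply/and3P; split=> //; first by apply/set0Pn; exists x0.
  by apply/subsetP => _ /imsetP[x xG ->]; exact: fG.
case/minset_exists => X /minsetP[/and3P[/set0Pn[x xX] XG fX] minX] _.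
(* The image of [X] is itself nonempty and closed, so minimality applies. *)
have fXX : f @: X = X.
  apply: minX => //; apply/and3P; split.
  - by apply/set0Pn; exists (f x); exact: imset_f.
  - exact: subset_trans XG.
  - exact: imsetS.
have injX : {in X &, injective f} by apply/imset_injP; rewrite fXX.
have clX : {in X, forall x, f x \in X} by move=> z zX; apply: (subsetP fX);
  exact: imset_f.
exists (orbit f x); first by rewrite -size_eq0 size_orbit -lt0n order_gt0.
rewrite /ucycle orbit_uniq andbT.
have := cycle_orbit_in clX injX xX.
apply: (sub_in_cycle (P := mem X)).
  by move=> y z yX _ /eqP <-; apply: fP; exact: (subsetP XG).
apply/allP => y; rewrite -fconnect_orbit => /iter_findex <-.
by elim: (findex _ _ _) => //= n; exact: clX.
Qed.

End Mate.

End Graphs.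

(** * Collapsing vertices *)

Section Collapse.
Variables (T T' : finType) (f : T -> T') (G : sgraph T).
Hypothesis uG : undirected G.
Local Notation G' := (drop_parallel (collapse f G)).

Lemma collapse_posP a b :
  reflect (exists x y, [/\ pos G x y, f x = a & f y = b]) (pos G' a b).
Proof.
apply: (iffP existsP) => [[x /andP[_ /existsP[y]]]|[x [y [pxy <- <-]]]].
  by case/and4P=> _ /eqP fx /eqP fy pxy; exists x, y.
exists x; rewrite (pos_vert uG pxy); apply/existsP; exists y.
rewrite !eqxx pxy /= andbT.
by rewrite (pos_sym uG) in pxy; exact: (pos_vert uG pxy).
Qed.

Lemma collapse_negP a b :
  reflect (exists x y, [/\ neg G x y, f x = a & f y = b])
          (neg (collapse f G) a b).
Proof.
apply: (iffP existsP) => [[x /andP[_ /existsP[y]]]|[x [y [nxy <- <-]]]].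
  by case/and4P=> _ /eqP fx /eqP fy nxy; exists x, y.
exists x; rewrite (neg_vert uG nxy); apply/existsP; exists y.
rewrite !eqxx nxy /= andbT.
by rewrite (neg_sym uG) in nxy; exact: (neg_vert uG nxy).
Qed.

Lemma undirected_collapse : undirected G'.
Proof.
have psym : symmetric (pos G').
  by move=> a b; apply/collapse_posP/collapse_posP => -[x [y [pxy fx fy]]];
    exists y, x; rewrite (pos_sym uG).
split=> [a b|a b|//|a b].
- by case/collapse_posP=> x [y [pxy <- _]]; rewrite imset_f ?(pos_vert uG pxy).
- case/andP=> /collapse_negP[x [y [nxy <- _]]] _.
  by rewrite imset_f ?(neg_vert uG nxy).
- rewrite /=; congr (_ && ~~ _); last exact: psym.
  by apply/collapse_negP/collapse_negP => -[x [y [nxy fx fy]]];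
    exists y, x; rewrite (neg_sym uG).
Qed.

Lemma sgraph_cover_uncollapse C :
  sgraph_cover G' C -> sgraph_cover G [set x in vert G | f x \in C].
Proof.
case=> _ stC covC; split=> [|x y|x y pxy].
- by apply/subsetP => x; rewrite inE => /andP[].
- rewrite !inE => /andP[xG fxC] /andP[yG fyC].
  (* A negative edge dropped in the collapse is parallel to a positive one, whose ends stability
     already keeps from both lying in [C]. *)
  have := stC _ _ fxC fyC; rewrite /adj; case/norP => npos.
  rewrite /= npos andbT => nneg; apply/norP; split.
    by apply: contra npos => pxy; apply/collapse_posP; exists x, y.
  by apply: contra nneg => nxy; apply/collapse_negP; exists x, y.
- have pyx := pxy; rewrite (pos_sym uG) in pyx.
  rewrite !inE (pos_vert uG pxy) (pos_vert uG pyx) /=; apply: covC.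
  by apply/collapse_posP; exists x, y.
Qed.

(** The first hypothesis makes [C] a union of classes, so a vertex of [G] lies in [C] as soon as its
    image lies in the image of [C]. *)
Lemma sgraph_cover_collapse (C : {set T}) :
    {in vert G &, forall x y, f x = f y -> x \in C -> y \in C} ->
  sgraph_cover G C -> sgraph_cover G' (f @: C).
Proof.
move=> satC [sCG stC covC].
have mem_C x : x \in vert G -> f x \in f @: C -> x \in C.
  by move=> xG /imsetP[y yC fxy]; apply: (satC y x) => //; exact: (subsetP sCG).
split=> [|a b aC bC|a b].
- exact: imsetS.
- apply/norP; split.
    apply/negP => /collapse_posP[x [y [pxy fx fy]]].
    have pyx := pxy; rewrite (pos_sym uG) in pyx.
    have := stC x y; rewrite !mem_C ?fx ?fy ?(pos_vert uG pxy) ?(pos_vert uG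
      pyx) //.
    by rewrite /adj pxy => /(_ isT isT).
  apply/negP => /andP[/collapse_negP[x [y [nxy fx fy]]] _].
  have nyx := nxy; rewrite (neg_sym uG) in nyx.
  have := stC x y; rewrite !mem_C ?fx ?fy ?(neg_vert uG nxy) ?(neg_vert uG nyx)
    //.
  by rewrite /adj nxy orbT => /(_ isT isT).
- case/collapse_posP=> x [y [/covC + <- <-]].
  by case/orP => inC; apply/orP; [left|right]; exact: imset_f.
Qed.

(** The hypotheses in turn give each class a positive neighbor, exclude positive loops, and make the
    neighbor unique. *)
Lemma matching_collapse :
    (forall x, x \in vert G -> exists y, pos G x y) ->
    (forall x y, pos G x y -> f x != f y) ->
    (forall x y x' y', pos G x y -> pos G x' y' -> f x = f x' -> f y = f y') ->
  matching G'.
Proof.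
move=> ex_pos f_neq f_fun; split.
- exact: undirected_collapse.
- move=> a; apply/collapse_posP => -[x [y [/f_neq/eqP fxy fx fy]]].
  by rewrite fx fy in fxy.
- move=> a b c /collapse_posP[x [y [pxy fx <-]]] /collapse_posP[x' [y' [pxy'
    fx' <-]]].
  by apply: f_fun pxy pxy' _; rewrite fx.
- move=> _ /imsetP[x /ex_pos[y pxy] ->]; exists (f y).
  by apply/collapse_posP; exists x, y.
- by move=> a b pab; apply/negP => /andP[_]; rewrite pab.
Qed.

End Collapse.

(** * Restriction to the vertices incident with a positive edge *)

Section PositiveVertices.
Variables (T : finType) (G : sgraph T).
Hypothesis uG : undirected G.
Local Notation G1 := (induced G (positive_vertices G)).

Lemma pos_positive_vertices x y : pos G x y -> x \in positive_vertices G.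
Proof. by move=> pxy; rewrite inE (pos_vert uG pxy); apply/existsP;
  exists y. Qed.

Lemma pos_induced : pos G1 =2 pos G.
Proof.
move=> x y /=; apply/and3P/idP => [[]//|pxy]; split=> //.
  exact: pos_positive_vertices pxy.
by rewrite (pos_sym uG) in pxy; exact: pos_positive_vertices pxy.
Qed.

Lemma positive_vertices_ex x : x \in vert G1 -> exists y, pos G1 x y.
Proof.
by rewrite !inE => /and3P[_ _ /existsP[y pxy]]; exists y; rewrite pos_induced.
Qed.

Lemma sgraph_cover_positive C :
  sgraph_cover G C -> sgraph_cover G1 (C :&: positive_vertices G).
Proof.
case=> sCG stC covC; split=> [|x y|x y].
- exact: setSI.
- rewrite !in_setI => /andP[xC xP] /andP[yC yP].
  by have := stC x y xC yC; rewrite /adj /= xP yP.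
- by case/and3P=> xP yP /covC; rewrite !in_setI xP yP !andbT.
Qed.

(** The restriction loses no positive edge, and no negative edge between two vertices that it
    keeps. *)
Lemma sgraph_cover_of_positive C : sgraph_cover G1 C -> sgraph_cover G C.
Proof.
case=> sCG stC covC; split=> [|x y xC yC|x y].
- by apply: subset_trans sCG _; exact: subsetIl.
- have := stC x y xC yC; rewrite /adj pos_induced /=.
  have /setIP[_ ->] := subsetP sCG x xC.
  by have /setIP[_ ->] := subsetP sCG y yC.
- by rewrite -pos_induced; exact: covC.
Qed.

End PositiveVertices.

(** * Bipartitions of the positive components *)

Section Bipartitions.
Variables (T : finType) (G : sgraph T).
Hypothesis uG : undirected G.
Local Notation H := (component G).

Lemma bipartition_pos K A x y :
  bipartition G K A -> x \in K -> y \in K -> pos G x y ->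
  (y \in A) = (x \notin A).
Proof.
case/andP=> _ /forallP/(_ x)/implyP bip xK yK pxy.
have /forallP/(_ y) := bip xK; rewrite yK pxy /=.
by case: (x \in A); case: (y \in A).
Qed.

Lemma component_refl x : x \in vert G -> x \in H x.
Proof. by rewrite inE => ->; rewrite connect0. Qed.

Lemma component_eq x y : y \in H x -> H y = H x.
Proof.
rewrite inE => /andP[_ cxy]; apply/setP => z; rewrite !inE.
by rewrite (same_connect (sym_connect_sym (pos_sym uG)) cxy).
Qed.

Lemma component_pos x y z : y \in H x -> pos G y z -> z \in H x.
Proof.
rewrite !inE => /andP[_ cxy] pyz; apply/andP; split; last first.
  by apply: connect_trans cxy _; exact: connect1.
by rewrite (pos_sym uG) in pyz; exact: (pos_vert uG pyz).
Qed.

(** Membership in either set switches along each positive edge, so agreement at [x] propagates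
    through its component. *)
Lemma bipartition_unique x A A' :
    bipartition G (H x) A -> bipartition G (H x) A' -> x \in A -> x \in A' ->
  A = A'.
Proof.
move=> bA bA' xA xA'.
have agree p u : u \in H x -> (u \in A) = (u \in A') -> path (pos G) u p ->
    (last u p \in A) = (last u p \in A').
  elim: p u => //= z p IH u uH eqA /andP[puz pz].
  have zH := component_pos uH puz; apply: IH pz => //.
  by rewrite (bipartition_pos bA uH zH puz) (bipartition_pos bA' uH zH puz) eqA.
have [sAH _] := andP bA; have [sAH' _] := andP bA'.
apply/setP => y; have [yH|yH] := boolP (y \in H x).
  move: yH; rewrite inE => /andP[_ /connectP[p px ->]].
  by apply: agree px; [exact: (subsetP sAH) | rewrite xA xA'].
by rewrite (contraNF (subsetP sAH y)) // (contraNF (subsetP sAH' y)).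
Qed.

Lemma bipartition_compl K A : bipartition G K A -> bipartition G K (K :\: A).
Proof.
move=> bA; apply/andP; split; first exact: subsetDl.
apply/forallP => x; apply/implyP => xK; apply/forallP => y; apply/implyP => yK.
apply/implyP => pxy; rewrite !inE xK yK (bipartition_pos bA xK yK pxy).
by case: (x \in A).
Qed.

(** A cover has exactly one end of every positive edge. Hence a component that is not bipartite
    rules out every cover. *)
Lemma cover_bipartition C x :
  sgraph_cover G C -> bipartition G (H x) (C :&: H x).
Proof.
move=> cC; apply/andP; split; first exact: subsetIr.
apply/forallP => y; apply/implyP => yH; apply/forallP => z; apply/implyP => zH.
apply/implyP => pyz; rewrite !in_setI yH zH !andbT.
by rewrite (sgraph_cover_pos cC pyz); case: (y \in C).
Qed.

Lemma bipartite_part :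
    (forall x, x \in vert G -> bipartite G (H x)) ->
  exists part : T -> {set T}, forall x, x \in vert G ->
    x \in part x /\ bipartition G (H x) (part x).
Proof.
move=> bip.
have partx x : exists A : {set T},
    (x \in vert G) ==> (x \in A) && bipartition G (H x) A.
  have [xG|_] := boolP (x \in vert G); last by exists set0.
  (* The side is made to contain [x], by passing to the complement if necessary. *)
  have /existsP[A bA] := bip x xG; have [xA|xA] := boolP (x \in A).
    by exists A; rewrite xA.
  by exists (H x :\: A); rewrite bipartition_compl // inE xA component_refl.
exists (fun x => xchoose (partx x)) => x xG.
by apply/andP; exact: (implyP (xchooseP (partx x))).
Qed.

(** * The side of a component that contains a given vertex *)

Section Part.
Variable part : T -> {set T}.
Hypothesis partP : forall x, x \in vert G ->
  x \in part x /\ bipartition G (H x) (part x).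

Lemma part_sub x : x \in vert G -> part x \subset H x.
Proof. by case/partP => _ /andP[]. Qed.

Lemma mem_part_vert x y : x \in vert G -> y \in part x -> y \in vert G.
Proof. by move=> /part_sub /subsetP + yx => /(_ y yx); rewrite inE =>
  /andP[]. Qed.

Lemma part_eq x y : x \in vert G -> y \in part x -> part y = part x.
Proof.
move=> xG yx; have [yy bipy] := partP (mem_part_vert xG yx).
have [_ bipx] := partP xG.
have Hyx := component_eq (subsetP (part_sub xG) y yx).
by apply: (bipartition_unique bipy _ yy yx); rewrite Hyx.
Qed.

Lemma part_pos_neq x y : pos G x y -> part x != part y.
Proof.
move=> pxy; have xG := pos_vert uG pxy; have [xx bipx] := partP xG.
have xH := component_refl xG; have yH := component_pos xH pxy.
have yG : y \in vert G by move: yH; rewrite inE => /andP[].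
apply: contraTneq xx => e; rewrite -(bipartition_pos bipx xH yH pxy) e.
by have [] := partP yG.
Qed.

Lemma part_pos_compl x y : pos G x y -> part y = H x :\: part x.
Proof.
move=> pxy; have xG := pos_vert uG pxy; have [xx bipx] := partP xG.
have xH := component_refl xG; have yH := component_pos xH pxy.
have yG : y \in vert G by move: yH; rewrite inE => /andP[].
have [yy bipy] := partP yG; have Hyx := component_eq yH.
apply: (bipartition_unique bipy _ yy); first by rewrite Hyx bipartition_compl.
by rewrite inE yH (bipartition_pos bipx xH yH pxy) xx.
Qed.

Lemma part_pos_fun x y x' y' :
  pos G x y -> pos G x' y' -> part x = part x' -> part y = part y'.
Proof.
move=> pxy pxy' e; rewrite (part_pos_compl pxy) (part_pos_compl pxy') e.
have xG := pos_vert uG pxy; have xG' := pos_vert uG pxy'.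
have [xx _] := partP xG; rewrite e in xx.
by rewrite (component_eq (subsetP (part_sub xG') x xx)).
Qed.

(** The trace of [C] on the component is a side containing [x], hence equals [part x], which also
    contains [y]. *)
Lemma part_cover C x y :
    sgraph_cover G C -> x \in vert G -> y \in vert G -> part x = part y ->
  x \in C -> y \in C.
Proof.
move=> cC xG yG e xC; have [xx bipx] := partP xG; have [yy _] := partP yG.
have bipC := cover_bipartition x cC.
have xCH : x \in C :&: H x by rewrite inE xC component_refl.
by move: yy; rewrite -e (bipartition_unique bipx bipC xx xCH) => /setIP[].
Qed.

Lemma matching_part :
    (forall x, x \in vert G -> exists y, pos G x y) ->
  matching (drop_parallel (collapse part G)).
Proof.
move=> ex_pos; apply: matching_collapse => //.
  exact: part_pos_neq.
exact: part_pos_fun.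
Qed.

Lemma cover_part_collapse (C : {set {set T}}) :
  C \subset vert (drop_parallel (collapse part G)) ->
  cover C = [set x in vert G | part x \in C].
Proof.
move=> sC; apply/setP => y; rewrite inE; apply/bigcupP/andP =>
  [[a aC ya]|[yG pC]].
  have /imsetP[x xG e] := subsetP sC a aC; rewrite e in ya aC.
  by rewrite (part_eq xG ya) (mem_part_vert xG ya).
by exists (part y) => //; have [] := partP yG.
Qed.

End Part.
End Bipartitions.

(** * Signed multigraphs and their adjacency relations *)

Section Adjacencies.
Variable Sg : signed_graph.
Local Notation A := (adjacencies Sg).

Lemma joinsC (e : edge Sg) a b : joins e a b = joins e b a.
Proof. exact: orbC. Qed.

Lemma undirected_adjacencies : undirected A.
Proof.
split=> [x y _|x y _|x y|x y] /=; rewrite ?inE //;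
  by apply: eq_existsb => e; rewrite joinsC.
Qed.

Lemma stable_cover_adjacencies C : stable_cover C <-> sgraph_cover A C.
Proof.
split=> [[stC covC]|[_ stC covC]].
  split=> [|x y xC yC|x y /existsP[e /andP[/covC + /orP[]/eqP je]]].
  - exact: subsetT.
  - apply/norP; split; apply/existsP => -[e /andP[_ /orP[]/eqP je]];
      by have := stC e; rewrite je /= xC yC.
  - by rewrite je.
  - by rewrite je orbC.
split=> e.
  apply/negP => /andP[xC yC]; have /negP[] := stC _ _ xC yC; apply/orP.
  by case sg: (sgn e); [left|right]; apply/existsP; exists e;
    rewrite sg /joins -surjective_pairing eqxx.
by move=> sg; apply: covC; apply/existsP; exists e;
  rewrite sg /joins -surjective_pairing eqxx.
Qed.

End Adjacencies.

(** * Identifying blocks of input vertices *)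

Section Identification.
Variables (V : finType) (G : sgraph {set V}) (P : {set {set V}}).
Hypothesis mG : matching G.
Hypothesis vert_neq0 : forall a, a \in vert G -> a != set0.
Hypothesis vert_disj :
  forall a b v, a \in vert G -> b \in vert G -> v \in a -> v \in b -> a = b.
Local Notation Q := [set mate G x | x in P].
Hypothesis PG : P \subset vert G.
Hypothesis disPQ : [disjoint P & Q].
Local Notation f := (identify2 P Q).

(** The kernel of [identify2] on the vertices of [G], made explicit. *)
Definition merged (a b : {set V}) : bool :=
  [|| a == b, (a \in P) && (b \in P) | (a \in Q) && (b \in Q)].

Lemma identify2_merged a b : merged a b -> f a = f b.
Proof.
rewrite /identify2 => /or3P[/eqP -> //|/andP[-> ->] //|/andP[aQ bQ]].
by rewrite aQ bQ !(disjointFl disPQ).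
Qed.

Lemma sub_identify2 (a : {set V}) : a \subset f a.
Proof.
rewrite /identify2; case: ifP => [aP|_]; first exact: bigcup_sup.
by case: ifP => [aQ|//]; exact: bigcup_sup.
Qed.

Lemma mate_vertQ a : a \in Q -> a \in vert G.
Proof. by case/imsetP=> p pP ->; apply: mate_vert => //;
  exact: (subsetP PG). Qed.

Lemma mem_identify2 a v :
    a \in vert G -> v \in f a ->
  exists b, [/\ b \in vert G, merged b a & v \in b].
Proof.
rewrite /identify2 => aG.
case: ifP => [aP /bigcupP[b bP vb]|_].
  by exists b; split=> //; [exact: (subsetP PG) | rewrite /merged aP bP orbT].
case: ifP => [aQ /bigcupP[b bQ vb]|_ va].
  by exists b; split=> //; [exact: mate_vertQ | rewrite /merged aQ bQ !orbT].
by exists a; rewrite /merged eqxx.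
Qed.

(** An input vertex of [a] lies in the common image, hence in some block merged with [b];
    disjointness of blocks makes that block [a]. *)
Lemma identify2_eq a b :
  a \in vert G -> b \in vert G -> f a = f b -> merged a b.
Proof.
move=> aG bG fab; have /set0Pn[v va] := vert_neq0 aG.
have : v \in f b by rewrite -fab (subsetP (sub_identify2 a)).
case/(mem_identify2 bG) => c [cG mcb vc].
by rewrite (vert_disj aG cG va vc).
Qed.

Lemma merged_pos a b a' b' :
  pos G a b -> pos G a' b' -> merged a a' -> merged b b'.
Proof.
move=> /(mate_eq mG) <- /(mate_eq mG) <-.
case/or3P=> [/eqP ->|/andP[aP aP']|/andP[/imsetP[p pP ->] /imsetP[p' pP' ->]]].
- by rewrite /merged eqxx.
- by rewrite /merged !(imset_f (mate G)) ?orbT.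
- by rewrite !mateK ?(subsetP PG) // /merged pP pP' orbT.
Qed.

Lemma pos_unmerged a b : pos G a b -> ~~ merged a b.
Proof.
move=> pab; have aG := pos_vert mG pab; rewrite -(mate_eq mG pab).
rewrite /merged eq_sym (negbTE (mate_neq mG aG)) /=; apply/norP; split.
  apply/negP => /andP[aP]; apply/negP.
  by rewrite (disjointFl disPQ) // imset_f.
apply/negP => /andP[/imsetP[p pP ap]]; rewrite ap mateK ?(subsetP PG) //.
by rewrite (disjointFr disPQ pP).
Qed.

Lemma matching_identify : matching (identify G P Q).
Proof.
apply: (matching_collapse mG).
- exact: (pos_ex mG).
- move=> a b pab; apply: contra (pos_unmerged pab) => /eqP.
  apply: identify2_eq; first exact: (pos_vert mG pab).
  by rewrite (pos_sym mG) in pab; exact: (pos_vert mG pab).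
- move=> a b a' b' pab pab' /identify2_eq maa'.
  apply: identify2_merged; apply: (merged_pos pab pab'); apply: maa'.
    exact: (pos_vert mG pab).
  exact: (pos_vert mG pab').
Qed.

(** A cover contains a mate exactly when it omits the vertex, so agreement on [P] carries over to
    [Q]. *)
Lemma merged_cover (C : {set {set V}}) a b :
    sgraph_cover G C -> {in P &, forall p q, p \in C -> q \in C} ->
  merged a b -> a \in C -> b \in C.
Proof.
move=> cC satC /or3P[/eqP -> //|/andP[aP bP]|]; first exact: satC.
case/andP=> /imsetP[p pP ->] /imsetP[q qP ->].
rewrite !(sgraph_cover_mate mG cC) ?(subsetP PG) //.
by apply: contra; exact: satC.
Qed.

Lemma sgraph_cover_identify (C : {set {set V}}) :
    sgraph_cover G C -> {in P &, forall p q, p \in C -> q \in C} ->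
  sgraph_cover (identify G P Q) (f @: C).
Proof.
move=> cC satC; apply: (sgraph_cover_collapse mG) => // a b aG bG fab.
by apply: (merged_cover cC satC); exact: identify2_eq.
Qed.

(** Recovery is unaffected by the identification: an image block is the union of the blocks merged
    into it. *)
Lemma cover_identify (C : {set {set V}}) :
    C \subset vert (identify G P Q) ->
  cover C = cover [set x in vert G | f x \in C].
Proof.
move=> sC; apply/setP => v; apply/bigcupP/bigcupP => [[a aC va]|[a]].
  have /imsetP[b bG ab] := subsetP sC a aC; rewrite ab in aC va.
  have [c [cG /identify2_merged mcb vc]] := mem_identify2 bG va.
  by exists c; rewrite // inE cG mcb.
rewrite inE => /andP[aG fC] va; exists (f a) => //.
exact: (subsetP (sub_identify2 a)).
Qed.

Lemma card_vert_identify a b :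
  a \in P -> b \in P -> a != b -> #|vert (identify G P Q)| < #|vert G|.
Proof.
move=> aP bP ab; rewrite ltn_neqAle leq_imset_card andbT.
apply: contra ab => /imset_injP inj; apply/eqP; apply: inj.
- exact: (subsetP PG).
- exact: (subsetP PG).
- by rewrite /identify2 aP bP.
Qed.

End Identification.

(** * The loop invariant *)

Section Invariant.
Variable Sg : signed_graph.
Local Notation V := (vertex Sg).
Implicit Types (G : sgraph {set V}) (S B C P : {set {set V}}).

(* B can keep vertices that have already left G, so [inv_disj] also says that
   no vertex created later by an identification is equal to one of them. *)
Record invariant G S B : Prop := Invariant {
  inv_matching : matching G;
  inv_neq0 : forall a, a \in vert G -> a != set0;
  inv_disj : forall a b v, a \in vert G -> b \in vert G :|: S :|: B ->
    v \in a -> v \in b -> a = b;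
  inv_done : [disjoint S & vert G];
  inv_sound : ~~ conflict S B -> forall C, sgraph_cover G C ->
    [disjoint C & B] -> stable_cover (cover (S :|: C));
  inv_complete : forall D : {set V}, stable_cover D ->
    ~~ conflict S B /\ exists2 C, sgraph_cover G C & [disjoint C & B]
}.

Lemma conflictPn S B : ~~ conflict S B = [disjoint S & B].
Proof. by rewrite /conflict negbK setI_eq0. Qed.

Lemma invariant_start (part : V -> {set V}) :
    let A := adjacencies Sg in let G := induced A (positive_vertices A) in
    (forall v, v \in vert G ->
       v \in part v /\ bipartition G (component G v) (part v)) ->
  invariant (drop_parallel (collapse part G)) set0 set0.
Proof.
move=> A G partP; have uA : undirected A := undirected_adjacencies Sg.
have uG : undirected G by exact: undirected_induced.
have exG := positive_vertices_ex uA.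
split.
- exact: matching_part.
- move=> _ /imsetP[v vG ->]; apply/set0Pn; exists v.
  by have [] := partP v vG.
- move=> _ b w /imsetP[v vG ->]; rewrite !setU0 => /imsetP[u uuG ->] wv wu.
  by rewrite -(part_eq uG partP vG wv) -(part_eq uG partP uuG wu).
- by rewrite disjoints_subset sub0set.
- move=> _ C cC _; have [sC _ _] := cC.
  rewrite set0U (cover_part_collapse uG partP sC);
    apply/stable_cover_adjacencies.
  by apply: sgraph_cover_of_positive => //; exact: sgraph_cover_uncollapse.
- move=> D /stable_cover_adjacencies /sgraph_cover_positive cD.
  split; first by rewrite conflictPn disjoints_subset sub0set.
  exists (part @: (D :&: positive_vertices A)).
    apply: sgraph_cover_collapse => // v w vG wG.
    exact: (part_cover uG partP cD).
  by rewrite disjoint_sym disjoints_subset sub0set.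
Qed.

(** Common to Steps 4, 6, 7 and 9. The bounds on [B'] allow the mate of [x] to be removed from the
    forbidden set, as in Step 4, or to stay there. The last hypothesis is an exchange property: any
    cover avoiding [B] can be replaced by one that also contains [x]. *)
Lemma invariant_force G S B B' x :
    invariant G S B -> x \in vert G ->
    (B :|: Nneg G x) :\ mate G x \subset B' -> B' \subset B :|: Nneg G x ->
    (forall C, sgraph_cover G C -> [disjoint C & B] ->
       exists C', [/\ sgraph_cover G C', [disjoint C' & B] & x \in C']) ->
  invariant (delete G [set x; mate G x]) (S :|: [set x]) B'.
Proof.
case=> mG neq0G disjG SG sound complete xG subB' supB' force.
have mB z : z \in B -> z != mate G x -> z \in B'.
  by move=> zB zm; apply: (subsetP subB'); rewrite !inE zm zB.
have mN z : neg G x z -> z \in B'.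
  move=> nxz; apply: (subsetP subB'); rewrite !inE nxz orbT andbT.
  by apply: contraTneq nxz => ->; apply: (pos_neg mG); exact: pos_mate.
have supB z : z \in B' -> z \in B \/ neg G x z.
  by move=> /(subsetP supB'); rewrite !inE => /orP[]; auto.
split.
- exact: matching_delete.
- by move=> a /setIP[aG _]; exact: neq0G.
- move=> a b v /setIP[aG _] + va vb; rewrite !in_setU.
  case/orP=> [/orP[/setIP[bG _]|/orP[bS|]]|/supB[bB|nxb]].
  + by apply: (disjG _ _ v) => //; rewrite !inE bG.
  + by apply: (disjG _ _ v) => //; rewrite !inE bS orbT.
  + by move/set1P=> bx; apply: (disjG _ _ v) => //; rewrite !inE bx xG.
  + by apply: (disjG _ _ v) => //; rewrite !inE bB orbT.
  + apply: (disjG _ _ v) => //; rewrite !inE.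
    by rewrite (neg_sym mG) in nxb; rewrite (neg_vert mG nxb).
- rewrite disjoints_subset; apply/subsetP => z; rewrite !inE.
  case/orP=> [zS|->]; last by rewrite andbF.
  by rewrite (disjointFr SG zS).
- rewrite conflictPn => disSB' C cC disCB'.
  (* A negative loop at [x] would put [x] in [B'] as well as in the new [S]; the absence of a
     conflict excludes this. *)
  have xB' : x \notin B' by rewrite (disjointFr disSB') // !inE eqxx orbT.
  (* Only the mate of [x] can lie in [B] but not in [B'], and as a vertex of [G] it is not in
     [S]. *)
  have disSB : [disjoint S & B].
    rewrite disjoints_subset; apply/subsetP => z zS; rewrite inE;
      apply/negP => zB.
    have : z \notin B' by rewrite (disjointFr disSB') // inE zS.
    rewrite mB //; apply: contraTneq zS => ->.
    by rewrite (disjointFl SG) // mate_vert.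
  have [sC _ _] := cC.
  rewrite -setUA; apply: sound; first by rewrite conflictPn.
    apply: sgraph_cover_restore => //.
      by apply: contra xB'; exact: mN.
    by move=> z zC; apply: contraFN (disjointFr disCB' zC); exact: mN.
  rewrite disjoints_subset; apply/subsetP => z; rewrite !inE.
  case/predU1P=> [->|zC]; apply/negP => zB.
    by rewrite mB // eq_sym mate_neq in xB'.
  have : z \notin B' by rewrite (disjointFr disCB').
  rewrite mB //; have /setIP[_] := subsetP sC z zC.
  by rewrite !inE negb_or => /andP[].
- move=> D /complete[+ [C0 cC0 disC0]]; rewrite !conflictPn => disSB.
  have [C [cC disC xC]] := force _ cC0 disC0.
  (* Containing [x], the cover omits the negative neighbors that [B'] may add to [B]. *)
  have disCB' : [disjoint C & B'].
    rewrite disjoints_subset; apply/subsetP => z zC; rewrite inE; apply/negP.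
    case/supB=> [zB|nxz]; first by rewrite (disjointFl disC zB) in zC.
    by have := sgraph_cover_neg cC nxz xC; rewrite zC.
  split.
    rewrite disjoints_subset; apply/subsetP => z; rewrite !inE.
    case/orP=> [zS|/eqP->]; last by rewrite (disjointFr disCB' xC).
    apply/negP; case/supB=> [zB|nxz];
      first by rewrite (disjointFl disSB zB) in zS.
    rewrite (neg_sym mG) in nxz.
    by rewrite (disjointFl SG (neg_vert mG nxz)) in zS.
  exists (C :\: [set x; mate G x]); first exact: sgraph_cover_delete.
  by apply: disjointWl disCB'; exact: subsetDl.
Qed.

(** Common to Steps 8 and 12. All forbidden vertices have left the graph, so none of them is
    merged. *)
Lemma invariant_identify G S B P :
    let Q := [set mate G x | x in P] in
    invariant G S B -> [disjoint B & vert G] -> P \subset vert G ->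
    [disjoint P & Q] ->
    (forall C, sgraph_cover G C -> {in P &, forall p q, p \in C -> q \in C}) ->
  invariant (identify G P Q) S B.
Proof.
move=> Q [mG neq0G disjG SG sound complete] BG PG disPQ satP.
have disjGG a b v : a \in vert G -> b \in vert G -> v \in a -> v \in b -> a = b.
  by move=> aG bG; apply: disjG; rewrite // !inE bG.
(* An image block consists of input vertices of blocks of [G], which share none with the blocks in
   [S] or [B]. *)
have outside a z v : a \in vert G -> v \in identify2 P Q a ->
    z \in S :|: B -> v \in z -> False.
  move=> aG vfa zSB vz; have [b [bG _ vb]] := mem_identify2 mG PG aG vfa.
  have bz : b = z by apply: (disjG _ _ v) => //; rewrite -setUA inE zSB orbT.
  rewrite -bz in zSB; move: zSB; rewrite inE.
  by rewrite (disjointFl SG bG) (disjointFl BG bG).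
have outside' a z : a \in vert G -> z \in S :|: B -> identify2 P Q a <> z.
  move=> aG zSB e; have /set0Pn[v va] := neq0G a aG.
  have vfa := subsetP (sub_identify2 G P a) v va.
  by apply: (outside a z v); rewrite // -e.
split.
- exact: matching_identify.
- move=> _ /imsetP[a aG ->]; have /set0Pn[v va] := neq0G a aG.
  by apply/set0Pn; exists v; exact: (subsetP (sub_identify2 G P a)).
- move=> _ b v /imsetP[a aG ->] + va vb; rewrite -setUA inE =>
    /orP[/imsetP[c cG bc]|].
    rewrite bc in vb *.
    have [a' [aG' maa' va']] := mem_identify2 mG PG aG va.
    have [c' [cG' mcc' vc']] := mem_identify2 mG PG cG vb.
    rewrite -(identify2_merged disPQ maa') -(identify2_merged disPQ mcc').
    by rewrite (disjGG a' c' v).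
  by move=> bSB; case: (outside a b v).
- rewrite disjoints_subset; apply/subsetP => z zS; rewrite inE; apply/negP.
  by case/imsetP=> a aG /esym; apply: outside'; rewrite // inE zS.
- move=> nconf C cC disCB; have [sC _ _] := cC.
  rewrite /cover bigcup_setU -!/(cover _) (cover_identify mG PG disPQ sC).
  rewrite /cover -bigcup_setU; apply: sound => //.
    exact: (sgraph_cover_uncollapse mG cC).
  rewrite disjoint_sym; apply: disjointWr BG.
  by apply/subsetP => z; rewrite inE => /andP[].
- move=> D /complete[nconf [C cC disC]]; split=> //.
  exists (identify2 P Q @: C).
    by apply: sgraph_cover_identify => //; exact: satP.
  rewrite disjoints_subset; apply/subsetP => _ /imsetP[a aC ->]; rewrite inE.
  apply/negP => fB; have [sC _ _] := cC.
  by apply: (outside' a) (erefl _); rewrite ?(subsetP sC) // inE fB orbT.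
Qed.

End Invariant.

(** * Executions *)

Lemma card_vert_delete (T : finType) (G : sgraph T) (X : {set T}) x :
  x \in vert G -> x \in X -> #|vert (delete G X)| < #|vert G|.
Proof.
move=> xG xX; apply/proper_card/properP; split; first exact: subsetIl.
by exists x; rewrite // !inE xX andbF.
Qed.

Section Execution.
Variable Sg : signed_graph.
Hypothesis chi3 : chromatic_number Sg 3.
Local Notation V := (vertex Sg).
Local Notation A := (adjacencies Sg).
Implicit Types (G : sgraph {set V}) (S B C : {set {set V}}) (s : state V).

(** A stable cover of the input entails the absence of a conflict, which may therefore be assumed; a
    conflict alone thus yields deficiency 0. *)
Lemma invariant_stop G S B :
    invariant G S B ->
    (~~ conflict S B -> forall C, sgraph_cover G C -> ~~ [disjoint C & B]) ->
  max_deficiency Sg 0.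
Proof.
move=> inv none; apply: max_deficiency0 => // -[D stD].
have [nconf [C cC disC]] := inv_complete inv stD.
by have := none nconf C cC; rewrite disC.
Qed.

(** If no cover avoiding [B] contains [x], each of them contains the mate, and no exchange is
    required. *)
Lemma invariant_force_mate G S B B' x :
    invariant G S B -> x \in vert G ->
    (B :|: Nneg G (mate G x)) :\ x \subset B' ->
    B' \subset B :|: Nneg G (mate G x) ->
    (forall C, sgraph_cover G C -> [disjoint C & B] -> x \notin C) ->
  invariant (delete G [set x; mate G x]) (S :|: [set mate G x]) B'.
Proof.
move=> inv xG subB' supB' xC; have mG := inv_matching inv.
rewrite setUC -{2}(mateK mG xG); apply: invariant_force supB' _ => //.
- exact: mate_vert.
- by rewrite mateK.
- by move=> C cC dC; exists C; split=> //; rewrite (sgraph_cover_mate mG) ?xC.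
Qed.

(** Every cover contains [y] or its mate, and [x] is adjacent to both. *)
Lemma cond7_notin G C x :
  matching G -> cond7 G x -> sgraph_cover G C -> x \notin C.
Proof.
move=> mG /andP[_ /existsP[y /and3P[yG axy axmy]]] cC; have [_ stC _] := cC.
apply/negP => xC; have := sgraph_cover_mate mG cC yG.
have [yC|yC] := boolP (y \in C); first by have := stC x y xC yC; rewrite axy.
by move=> mC; have := stC x _ xC mC; rewrite axmy.
Qed.

(** Having no negative neighbor, [x] can replace its mate in any cover; the new cover stays inside
    [G], hence off [B]. *)
Lemma cond9_swap G B C x :
    matching G -> [disjoint B & vert G] -> cond9 G x -> sgraph_cover G C ->
  exists C', [/\ sgraph_cover G C', [disjoint C' & B] & x \in C'].
Proof.
move=> mG BG /andP[xG /eqP deg1] cC.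
exists (x |: (C :\: [set x; mate G x])); have nx y := leaf_no_neg mG y xG deg1.
have cC' : sgraph_cover G (x |: (C :\: [set x; mate G x])).
  by apply: (sgraph_cover_restore mG); rewrite ?nx //;
    exact: sgraph_cover_delete.
split=> //; last by rewrite setU11.
by rewrite disjoint_sym; have [sC _ _] := cC'; exact: disjointWr sC BG.
Qed.

(** * Two matched pairs joined by two disjoint edges *)

Section Step8.
Variables (G : sgraph {set V}) (x y : {set V}).
Hypothesis mG : matching G.
Hypothesis c8 : cond8 G x y.

Lemma cond8_mates :
  [set mate G x; y] = [set mate G z | z in [set x; mate G y]].
Proof.
by case/and4P: c8 => _ yG _ _; rewrite imsetU !imset_set1 mateK.
Qed.

Lemma cond8_neq : x != mate G y.
Proof.
case/and5P: c8 => xG yG _ ymx _.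
by apply: contraNneq ymx => ->; rewrite mateK.
Qed.

Lemma cond8_sub : [set x; mate G y] \subset vert G.
Proof.
case/and3P: c8 => xG yG _.
by rewrite subUset !sub1set xG mate_vert.
Qed.

Lemma cond8_disjoint : [disjoint [set x; mate G y] & [set mate G x; y]].
Proof.
case/and5P: c8 => xG yG yx ymx _.
rewrite disjoints_subset subUset !sub1set !inE !negb_or.
rewrite eq_sym mate_neq // eq_sym yx mate_neq //= andbT.
by apply: contraNneq yx => e; rewrite -(mateK mG yG) e mateK.
Qed.

(** With [x], a cover omits [y] and contains the mate of [y]; with that mate, it omits the mate of
    [x] and contains [x]. *)
Lemma cond8_cover C :
  sgraph_cover G C -> {in [set x; mate G y] &, forall p q, p \in C -> q \in C}.
Proof.
case/and5P: c8 => xG yG _ _ /andP[axy amm] cC; have [_ stC _] := cC.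
have mx := sgraph_cover_mate mG cC xG; have my := sgraph_cover_mate mG cC yG.
have xy : (mate G y \in C) = (x \in C).
  apply/idP/idP => [myC|xC].
    rewrite -[_ \in C]negbK -mx; apply/negP => mxC.
    by have := stC _ _ mxC myC; rewrite amm.
  by rewrite my; apply/negP => yC; have := stC x y xC yC; rewrite axy.
by move=> p q; rewrite !inE => /orP[] /eqP -> /orP[] /eqP ->; rewrite ?xy.
Qed.

End Step8.

(** * Cycles of the forcing graph and their mates *)

Section Step12.
Variables (G : sgraph {set V}) (c : seq {set V}).
Hypothesis mG : matching G.
Hypothesis c_neq0 : c != [::].
Hypothesis cycc : ucycle (forcing G) c.
Local Notation c' := (rev [seq mate G x | x <- c]).

Lemma forcing_cycle_vert : {subset c <= vert G}.
Proof. by apply: cycle_forcing_vert => //; case/andP: cycc. Qed.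

Lemma forcing_cycle_mates :
  [set x in c'] = [set mate G z | z in [set x in c]].
Proof.
apply/setP => z; rewrite inE mem_rev.
apply/mapP/imsetP => -[p pc ->]; exists p => //; first by rewrite inE.
by rewrite inE in pc.
Qed.

(** Some vertex and its mate both lie on the cycle: a cover would contain both or neither, yet it
    contains exactly one. *)
Lemma forcing_cycle_meet C : has (mem c) c' -> ~ sgraph_cover G C.
Proof.
case/hasP=> z; rewrite mem_rev => /mapP[p pc ->] /= mpc cC.
have [cyc _] := andP cycc.
have mp := sgraph_cover_mate mG cC (forcing_cycle_vert pc).
have [pC|pC] := boolP (p \in C).
  by have := cycle_forcing_cover mG cC cyc pc pC mpc; rewrite mp pC.
have mpC : mate G p \in C by rewrite mp.
by have := cycle_forcing_cover mG cC cyc mpc mpC pc; rewrite (negbTE pC).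
Qed.

Lemma forcing_cycle_disjoint :
  ~~ has (mem c) c' -> [disjoint [set x in c] & [set x in c']].
Proof.
move=> /hasPn ncc; rewrite disjoints_subset; apply/subsetP => z;
  rewrite !inE => zc.
by apply/negP => /ncc /=; rewrite zc.
Qed.

Lemma forcing_cycle_cover C :
  sgraph_cover G C -> {in [set x in c] &, forall p q, p \in C -> q \in C}.
Proof.
move=> cC p q; rewrite !inE => pc qc pC.
by apply: (cycle_forcing_cover mG cC _ pc pC); case/andP: cycc.
Qed.

(** Without loops in the forcing graph the cycle has at least two vertices, so contracting it makes
    the graph smaller. *)
Lemma forcing_cycle_two : exists a b, [/\ a \in c, b \in c & a != b].
Proof.
case: c c_neq0 cycc => // a [|b p] _ /andP[/= cyc unq].
  by rewrite andbT (negbTE (forcing_irr mG a)) in cyc.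
exists a, b; rewrite !inE !eqxx orbT; split=> //.
by case/andP: unq; rewrite inE negb_or => /andP[].
Qed.

End Step12.

(** The guards on [n] record what the failed tests have established: no conflict after Step 3, [B]
    off the graph after Step 4, no degree one after Step 9, a nonempty graph after Step 10. *)
Definition state_invariant s : Prop :=
  match s with
  | AtStep1 G => G = A
  | AtStep2 G => G = induced A (positive_vertices A)
  | AtStep n G S0 B =>
      [/\ 3 <= n <= 11, invariant G S0 B, 3 < n -> ~~ conflict S0 B,
          4 < n -> [disjoint B & vert G]
        & (9 < n -> {in vert G, forall x, degree G x != 1}) /\
          (10 < n -> vert G <> set0)]
  | AtStep12 G S0 B c c' =>
      [/\ invariant G S0 B, ~~ conflict S0 B, [disjoint B & vert G],
          c != [::] /\ ucycle (forcing G) c & c' = rev [seq mate G x | x <- c]]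
  | Done o => correct_output Sg o
  end.

Lemma state_invariant3 G S B : invariant G S B -> state_invariant (AtStep 3 G S
  B).
Proof. by []. Qed.

Lemma undirected_positive : undirected (induced A (positive_vertices A)).
Proof. by apply: undirected_induced; exact: undirected_adjacencies. Qed.

Lemma state_invariant_step s s' :
  state_invariant s -> maxdef_step s s' -> state_invariant s'.
Proof.
move=> I st; case: s s' / st I.
- by move=> G ->.
- move=> G v vG nbip eG; apply: max_deficiency0 => // -[D].
  move=> /stable_cover_adjacencies /sgraph_cover_positive cD.
  case/negP: nbip; rewrite eG; apply/existsP.
  by eexists; exact: (cover_bipartition v cD).
- move=> G part partP eG; apply: state_invariant3; rewrite eG in partP *.
  exact: invariant_start.
- move=> G S B /existsP[x /and3P[xG xB mB]] [_ inv _ _ _].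
  apply: (invariant_stop inv) => _ C cC; apply/negP => dis.
  have := sgraph_cover_mate (inv_matching inv) cC xG.
  by rewrite (disjointFl dis xB) (disjointFl dis mB).
- move=> G S B conf [_ inv _ _ _].
  by apply: (invariant_stop inv); rewrite conf.
- by move=> G S B _ nconf [_ inv _ _ _].
- move=> G S B x /andP[xG xB] [_ inv _ _ _]; apply: state_invariant3.
  apply: (invariant_force_mate inv); rewrite ?subsetDl //.
  by move=> C _ dis; rewrite (disjointFl dis xB).
- move=> G S B nc4 [_ inv nconf _ _]; split=> // _.
  rewrite disjoints_subset; apply/subsetP => x xB; rewrite inE.
  by have := nc4 x; rewrite /cond4 xB andbT.
- move=> G S B x /and3P[xG lx lmx] [_ inv _ _ _].
  apply: (invariant_stop inv) => _ C cC; exfalso.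
  have := sgraph_cover_mate (inv_matching inv) cC xG.
  have [xC|xC] := boolP (x \in C).
    by have := sgraph_cover_neg cC lx xC; rewrite xC.
  by move=> mC; have := sgraph_cover_neg cC lmx mC; rewrite mC.
- by move=> G S B _ [_ inv nconf BG _].
- move=> G S B x /andP[xG lx] [_ inv _ _ _]; apply: state_invariant3.
  apply: (invariant_force_mate inv); rewrite ?subsetDl //.
  by move=> C cC _; apply/negP => xC; have := sgraph_cover_neg cC lx xC;
    rewrite xC.
- by move=> G S B _ [_ inv nconf BG _].
- move=> G S B x c7 [_ inv _ _ _]; apply: state_invariant3.
  have [xG _] := andP c7.
  apply: (invariant_force_mate inv); rewrite ?subsetDl //.
  by move=> C cC _; apply: cond7_notin c7 cC; exact: inv_matching inv.
- by move=> G S B _ [_ inv nconf BG _].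
- move=> G S B x y c8 [_ inv _ BG _]; apply: state_invariant3.
  have mG := inv_matching inv; have := cond8_disjoint mG c8.
  rewrite (cond8_mates mG c8) => dis.
  apply: (invariant_identify inv); rewrite ?BG //; first exact: cond8_sub.
  by move=> C; exact: cond8_cover.
- by move=> G S B _ [_ inv nconf BG _].
- move=> G S B x c9 [_ inv _ BG _]; apply: state_invariant3.
  have [xG _] := andP c9.
  apply: (invariant_force inv); rewrite ?subsetDl //.
  by move=> C cC _; apply: cond9_swap cC => //;
    [exact: inv_matching inv | exact: BG].
- move=> G S B nc9 [_ inv nconf BG _]; split=> //; split=> // _ x xG.
  by have := nc9 x; rewrite /cond9 xG.
- move=> G S B G0 [_ inv nconf BG _] /=.
  suff cS : stable_cover (cover S) by split=> //; exact: max_deficiency1 cS.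
  (* The empty set covers the empty graph, so soundness makes [S] alone expand to a stable cover of
     the input. *)
  have := inv_sound inv (nconf isT) (C := set0); rewrite setU0; apply.
    split=> [|x|x y /(pos_vert (inv_matching inv))]; rewrite ?sub0set ?inE //.
    by rewrite G0 inE.
  by rewrite disjoints_subset sub0set.
- by move=> G S B G0 [_ inv nconf BG [deg _]].
- by move=> G S B c c0 cycc [_ inv nconf BG _]; split=> //;
    [exact: nconf|exact: BG].
- move=> G S B c c' meet [inv _ _ [c0 cycc] ec'].
  apply: (invariant_stop inv) => _ C cC; exfalso; rewrite ec' in meet.
  exact: (forcing_cycle_meet (inv_matching inv) cycc meet cC).
- move=> G S B c c' nmeet [inv _ BG [c0 cycc] ec']; apply: state_invariant3.
  have mG := inv_matching inv; rewrite ec' in nmeet *.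
  have := forcing_cycle_disjoint nmeet; rewrite forcing_cycle_mates => dis.
  apply: (invariant_identify inv) => //.
    by apply/subsetP => x; rewrite inE; exact: forcing_cycle_vert.
  by move=> C; exact: forcing_cycle_cover.
Qed.

Lemma run_invariant n s : maxdef_run Sg n s -> state_invariant s.
Proof. by elim=> // {}n s1 s2 _; exact: state_invariant_step. Qed.

(** * Progress and termination *)

Lemma state_progress s :
  state_invariant s -> (exists s', maxdef_step s s') \/ (exists o, s = Done o).
Proof.
case: s => [G|G|n G S B|G S B c c'|o] I; last by right; exists o.
- by left; eexists; exact: Step1.
- left; have uG : undirected G by rewrite I; exact: undirected_positive.
  have [/existsP[v /andP[vG nbip]]|bip] :=
    boolP [exists v, (v \in vert G) && ~~ bipartite G (component G v)].
    by eexists; exact: Step2_stop vG nbip.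
  have [v vG|part partP] := bipartite_part (G := G).
    by apply: contraNT bip => nbip; apply/existsP; exists v; rewrite vG.
  by eexists; exact: Step2 partP.
- have pick1 (c : pred {set V}) : (exists x, c x) \/ (forall x, ~~ c x).
    by case: (pickP c) => [x cx|nc]; [left; exists x | right=> x; rewrite nc].
  case: I => /andP[n3 n11] inv nconf _ [deg G0]; left.
  case: n n3 n11 nconf deg G0 =>
    [|[|[|[|[|[|[|[|[|[|[|[|n]]]]]]]]]]]] // _ _ _ deg G0.
  + have [c3|c3] := boolP (cond3 G B); first by eexists; exact: Step3_stop.
    have [cf|cf] := boolP (conflict S B); first by eexists;
      exact: Step3_conflict.
    by eexists; exact: Step3_next.
  + have [[x cx]|nc] := pick1 (cond4 G B); eexists.
      exact: Step4 cx.
    exact: Step4_next.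
  + have [[x cx]|nc] := pick1 (cond5 G); eexists.
      exact: Step5_stop cx.
    exact: Step5_next.
  + have [[x cx]|nc] := pick1 (cond6 G); eexists.
      exact: Step6 cx.
    exact: Step6_next.
  + have [[x cx]|nc] := pick1 (cond7 G); eexists.
      exact: Step7 cx.
    exact: Step7_next.
  + have [[x /existsP[y cxy]]|nc] := pick1 (fun x => [exists y, cond8 G x y]).
      by eexists; exact: Step8 cxy.
    eexists; apply: Step8_next => x y; have := nc x.
    by apply: contra => cxy; apply/existsP; exists y.
  + have [[x cx]|nc] := pick1 (cond9 G); eexists.
      exact: Step9 cx.
    exact: Step9_next.
  + have [e|/eqP ne] := eqVneq (vert G) set0; eexists.
      exact: Step10_stop.
    exact: Step10_next.
  (* The outcomes of Steps 9 and 10, kept in the invariant, guarantee a cycle. *)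
  + have [c c0 cycc] := forcing_cycle_ex (inv_matching inv) (G0 isT) (deg isT).
    by eexists; exact: Step11 cycc.
- left; have [meet|nmeet] := boolP (has (mem c) c'); eexists.
    exact: Step12_stop.
  exact: Step12.
Qed.

(* The weight 10 makes the loss of a vertex outweigh the return to Step 3 from
   any of Steps 4 to 12. *)
Definition state_measure s : nat :=
  match s with
  | AtStep1 G => 10 * #|vert G| + 12
  | AtStep2 G => 10 * #|vert G| + 11
  | AtStep n G _ _ => 10 * #|vert G| + (13 - n)
  | AtStep12 G _ _ _ _ => 10 * #|vert G| + 1
  | Done _ => 0
  end.

(** Besides its vertices a state at Step 3 weighs 13 - 3 = 10, which the loss of one vertex pays
    for; the remaining [m.+1] makes the decrease strict. *)
Lemma state_measure3 G G' S B m :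
  #|vert G'| < #|vert G| ->
  state_measure (AtStep 3 G' S B) < 10 * #|vert G| + m.+1.
Proof.
move=> lt; rewrite /= addnS ltnS; apply: leq_trans (leq_addr _ _).
by rewrite subSS -mulnSr leq_mul2l lt orbT.
Qed.

Lemma state_measure_step s s' :
  state_invariant s -> maxdef_step s s' -> state_measure s' < state_measure s.
Proof.
move=> I st; case: s s' / st I => //.
- move=> G _; rewrite /= [_ + 12]addnS ltnS leq_add2r leq_mul2l /=.
  by rewrite subset_leq_card // subsetIl.
- by move=> G v vG _ _; rewrite /= addnS.
- move=> G part _ _; rewrite /= [_ + 11]addnS ltnS leq_add2r leq_mul2l /=.
  exact: leq_imset_card.
- by move=> G S B _ _; rewrite /= addnS.
- by move=> G S B _ _; rewrite /= addnS.
- by move=> G S B _ _ _; rewrite /= ltn_add2l.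
- move=> G S B x /andP[xG _] _; apply: state_measure3 => //.
  by apply: card_vert_delete xG _; rewrite !inE eqxx.
- by move=> G S B _ _; rewrite /= ltn_add2l.
- by move=> G S B x _ _; rewrite /= addnS.
- by move=> G S B _ _; rewrite /= ltn_add2l.
- move=> G S B x /andP[xG _] _; apply: state_measure3 => //.
  by apply: card_vert_delete xG _; rewrite !inE eqxx.
- by move=> G S B _ _; rewrite /= ltn_add2l.
- move=> G S B x /andP[xG _] _; apply: state_measure3 => //.
  by apply: card_vert_delete xG _; rewrite !inE eqxx.
- by move=> G S B _ _; rewrite /= ltn_add2l.
- move=> G S B x y c8 [_ inv _ _ _]; apply: state_measure3 => //.
  have mG := inv_matching inv; rewrite (cond8_mates mG c8).
  apply: card_vert_identify (cond8_neq mG c8); rewrite ?inE ?eqxx ?orbT //.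
  exact: cond8_sub.
- by move=> G S B _ _; rewrite /= ltn_add2l.
- move=> G S B x /andP[xG _] _; apply: state_measure3 => //.
  by apply: card_vert_delete xG _; rewrite !inE eqxx.
- by move=> G S B _ _; rewrite /= ltn_add2l.
- by move=> G S B _ _; rewrite /= addnS.
- by move=> G S B _ _; rewrite /= ltn_add2l.
- by move=> G S B c _ _ _; rewrite /= ltn_add2l.
- by move=> G S B c c' _ _; rewrite /= addnS.
- move=> G S B c c' _ [inv _ _ [c0 cycc] ->]; apply: state_measure3 => //.
  have mG := inv_matching inv;
    have [a [b [ac bc ab]]] := forcing_cycle_two mG c0 cycc.
  rewrite forcing_cycle_mates; apply: card_vert_identify ab; rewrite ?inE //.
  by apply/subsetP => x; rewrite inE; exact: forcing_cycle_vert.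
Qed.

(** Each transition lengthens the run by one and lowers the measure by at least one, so the sum
    never grows. *)
Lemma run_bound n s :
  maxdef_run Sg n s -> n + state_measure s <= state_measure (AtStep1 A).
Proof.
elim=> [|{}n s1 s2 run IH st]; first by [].
apply: leq_trans IH; rewrite addSnnS leq_add2l.
by apply: state_measure_step st; exact: run_invariant run.
Qed.

End Execution.

Theorem theorem3p5 (Sg : signed_graph) (chi3 : chromatic_number Sg 3) :
  (* correctness: no execution gets stuck, and every answer is right *)
  (forall n s, maxdef_run Sg n s ->
     (exists s', maxdef_step s s') \/ (exists o, s = Done o)) /\
  (forall n o, maxdef_run Sg n (Done o) -> correct_output Sg o) /\
  (* finiteness: the executions have bounded length *)
  (exists N, forall n s, maxdef_run Sg n s -> n <= N).
Proof.
split; first by move=> n s /(run_invariant chi3); exact: state_progress.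
split; first by move=> n o /(run_invariant chi3).
exists (state_measure (AtStep1 (adjacencies Sg))) => n s /(run_bound chi3).
by apply: leq_trans; exact: leq_addr.
Qed.
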